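(* Let $G$ be a $3$-connected graph in $\mathcal{G}_2$ in which every $3$-cutset is a stable set. If $G$ is not isomorphic to the Petersen graph, then $G$ has no induced subgraph isomorphic to $\theta^+$.
   Context: All graphs are finite and simple. A hole is an induced cycle of length at least $4$; an odd hole is a hole of odd length. $\mathcal{G}_2$ is the family of graphs of girth exactly $5$ having no odd holes of length at least $7$. A $3$-cutset is a set of $3$ vertices whose removal disconnects the graph; a set is stable if it induces no edges. $\theta^+$ is the graph obtained from the Petersen graph by deleting two adjacent vertices; equivalently, the graph on vertices $v_0,\ldots,v_7$ consisting of the $8$-cycle $v_0v_1\cdots v_7v_0$ together with the chords $v_0v_4$ and $v_2v_6$. *)

(* Defs.v *)
From mathcomp Require Import all_boot.

Set Implicit Arguments.
Unset Strict Implicit.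
Unset Printing Implicit Defensive.

Record sgraph := SGraph {
  vertex :> finType;
  edge : rel vertex;
  edge_sym : symmetric edge;
  edge_irrefl : irreflexive edge
}.

Definition isomorphic (G H : sgraph) : Prop :=
  exists2 f : G -> H, bijective f & forall x y, edge (f x) (f y) = edge x y.

Definition induced_edge (G : sgraph) (S : {set G}) : rel {x : G | x \in S} :=
  fun x y => edge (val x) (val y).

Lemma induced_edge_sym (G : sgraph) (S : {set G}) : symmetric (@induced_edge G S).
Proof. by move=> x y; apply: edge_sym. Qed.

Lemma induced_edge_irrefl (G : sgraph) (S : {set G}) :
  irreflexive (@induced_edge G S).
Proof. by move=> x; apply: edge_irrefl. Qed.

Definition induced (G : sgraph) (S : {set G}) : sgraph :=
  SGraph (@induced_edge_sym G S) (@induced_edge_irrefl G S).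

Definition has_induced (G H : sgraph) : Prop :=
  exists S : {set G}, isomorphic (induced S) H.

(* By this definition the empty graph is connected.  This is harmless in
   k_connected, where what remains is never empty, and in k_cutset it means that
   the whole vertex set is not a cutset. *)
Definition connected (G : sgraph) : Prop :=
  forall x y : G, connect (@edge G) x y.

Definition k_connected (k : nat) (G : sgraph) : Prop :=
  k < #|G| /\ forall S : {set G}, #|S| < k -> connected (induced (~: S)).

Definition k_cutset (k : nat) (G : sgraph) (S : {set G}) : Prop :=
  #|S| = k /\ ~ connected (induced (~: S)).

Definition stable (G : sgraph) (S : {set G}) : Prop :=
  {in S &, forall x y, ~~ edge x y}.

(* A cycle is the cyclic sequence of its vertices, without repetition; the lower
   bound on its size excludes the degenerate closed walks x and x-y-x. *)
Definition is_cycle (G : sgraph) (c : seq G) : bool :=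
  (2 < size c) && ucycleb (@edge G) c.

Definition has_girth (G : sgraph) (g : nat) : Prop :=
  (exists2 c : seq G, is_cycle c & size c = g) /\
  (forall c : seq G, is_cycle c -> g <= size c).

Definition is_hole (G : sgraph) (c : seq G) : Prop :=
  [/\ is_cycle c, 3 < size c &
      {in c &, forall x y, edge x y -> (y == next c x) || (x == next c y)}].

Definition in_G2 (G : sgraph) : Prop :=
  has_girth G 5 /\
  ~ (exists c : seq G, [/\ is_hole c, odd (size c) & 7 <= size c]).

(* The Petersen graph as the Kneser graph K(5, 2). *)
Definition petersen_vertex : finType := {A : {set 'I_5} | #|A| == 2}.

Definition petersen_edge : rel petersen_vertex :=
  fun A B => [disjoint val A & val B].

Lemma petersen_edge_sym : symmetric petersen_edge.
Proof. by move=> A B; apply: disjoint_sym. Qed.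

Lemma petersen_edge_irrefl : irreflexive petersen_edge.
Proof.
by move=> [A cA]; rewrite /petersen_edge /= -setI_eq0 setIid -cards_eq0 (eqP cA).
Qed.

Definition petersen : sgraph := SGraph petersen_edge_sym petersen_edge_irrefl.

(* On 'I_8, ordS is the successor modulo 8. *)
Definition theta_plus_edge : rel 'I_8 := fun i j =>
  [|| j == ordS i, i == ordS j |
      (i : nat, j : nat) \in [:: (0, 4); (4, 0); (2, 6); (6, 2)]].

Lemma theta_plus_edge_sym : symmetric theta_plus_edge.
Proof.
by case=> [] [|[|[|[|[|[|[|[|]]]]]]]] //= ? [] [|[|[|[|[|[|[|[|]]]]]]]].
Qed.

Lemma theta_plus_edge_irrefl : irreflexive theta_plus_edge.
Proof. by case=> [] [|[|[|[|[|[|[|[|]]]]]]]]. Qed.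

Definition theta_plus : sgraph :=
  SGraph theta_plus_edge_sym theta_plus_edge_irrefl.

(* Main.v *)
(** An induced theta_plus is grown inside G: a vertex attached at two of its
    vertices turns it into the Petersen graph minus a vertex, and a further one
    into the Petersen graph or the Petersen graph minus an edge.  Call H the copy
    reached, so that each vertex outside H has at most one neighbour in H.  An
    induced path outside H reads off the word of its attachments; if two letters
    s, t of the word are joined in H by induced paths of both parities avoiding
    the letters in between, one of these paths closes to an odd hole of length at
    least 7.  Only the order of first occurrences in a word matters, so the
    possible words form a finite automaton, which is computed.  Unless H is
    theta_plus, the attachments of a component outside H form a clique, hence at
    most two vertices, against 3-connectivity; so if H is the Petersen graph it is
    G.  If H is theta_plus, they form one of the paths 1-0-4-3, 7-0-4-5, 1-2-6-7,
    3-2-6-5.  Each of the vertices 1, 3, 5, 7 has a neighbour outside H, so two of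
    these paths with the same middle edge occur, and connections through the two
    components close to an odd hole. *)

Require Import Defs.
From mathcomp Require Import all_boot.
From mathcomp Require Import zify.

Set Implicit Arguments.
Unset Strict Implicit.
Unset Printing Implicit Defensive.

(** * Induced paths *)

(** Pairs are tested in list order only, so for a symmetric [e] the listed vertices induce a
    path. *)
Fixpoint ipath (T : eqType) (e : rel T) (c : seq T) : bool :=
  if c is x :: c' then
    [&& x \notin c',
        (if c' is y :: c'' then e x y && ~~ has (e x) c'' else true) &
        ipath e c']
  else true.

Section InducedPaths.

Variables (T : eqType) (e : rel T).
Implicit Types (x y z : T) (c p q : seq T).

Lemma ipath_uniq c : ipath e c -> uniq c.
Proof. by elim: c => //= x c IH /and3P[-> _ /IH]. Qed.

Lemma ipath_path x c : ipath e (x :: c) -> path e x c.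
Proof.
elim: c x => //= y c IH x /and3P[_ /andP[-> _] pc] /=.
exact: IH.
Qed.

Lemma ipath_headE x y c z :
  ipath e (x :: y :: c) -> z \in y :: c -> e x z = (z == y).
Proof.
case/and3P=> _ /andP[exy nex] _; rewrite inE.
case: eqP => [->|_] //= zc.
by apply: contraNF nex => exz; apply/hasP; exists z.
Qed.

Lemma ipath_lastE y c z w :
  ipath e (y :: rcons c z) -> w \in y :: c -> e w z = (w == last y c).
Proof.
elim: c y => [|v c IH] y ic.
  rewrite inE => /eqP->; rewrite eqxx.
  by case/and3P: ic => _ /andP[].
have /= /and3P[yN _ _] := ipath_uniq ic.
rewrite inE => /predU1P[->|wc]; last by apply: IH => //; case/and3P: ic.
have -> : (y == last v c) = false.
  apply/negP => /eqP yl; move: yN.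
  by rewrite -rcons_cons mem_rcons in_cons yl mem_last orbT.
have -> := @ipath_headE y v (rcons c z) z ic.
  apply/negP => /eqP zv; have /andP[_] := ipath_uniq ic.
  by rewrite zv /= mem_rcons mem_head.
by rewrite -rcons_cons mem_rcons mem_head.
Qed.

Lemma ipath_catl c1 c2 : ipath e (c1 ++ c2) -> ipath e c1.
Proof.
elim: c1 => //= x c1 IH /and3P[xc he /IH ->]; rewrite andbT.
move: xc; rewrite mem_cat negb_or => /andP[-> _] /=.
by case: c1 he {IH} => //= y c1; rewrite has_cat negb_or => /and3P[-> ->].
Qed.

Lemma ipath_catr c1 c2 : ipath e (c1 ++ c2) -> ipath e c2.
Proof. by elim: c1 => //= x c1 IH /and3P[_ _ /IH]. Qed.

Lemma ipath_cat x c1 y c2 :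
  ipath e (x :: c1) -> ipath e (y :: c2) ->
  {in x :: c1 & y :: c2, forall a b,
     a != b /\ e a b = (a == last x c1) && (b == y)} ->
  ipath e (x :: c1 ++ y :: c2).
Proof.
elim: c1 x => [|z c1 IH] x p1 p2 cross.
  have x1 : x \in [:: x] by rewrite inE.
  apply/and3P; split=> //.
    by apply/negP => xc; have [] := cross _ _ x1 xc; rewrite eqxx.
  have [_ ->] := cross _ _ x1 (mem_head _ _); rewrite !eqxx /=.
  apply/hasPn => b bc; have [|_ ->] := cross x b x1; first by rewrite inE bc orbT.
  rewrite eqxx /=; apply: contraTneq bc => ->.
  by case/andP: (ipath_uniq p2).
have xh : x \in x :: z :: c1 by rewrite inE eqxx.
have /andP[xl _] := ipath_uniq p1.
have xnl : x != last x (z :: c1) by apply: contraNneq xl => {1}->; apply: (mem_last z c1).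
case/and3P: (p1) => _ /andP[exz nex] p1'.
apply/and3P; split.
- rewrite -[X in x \notin X]/((z :: c1) ++ y :: c2) mem_cat negb_or xl /=.
  by apply/negP => xc; have [] := cross _ _ xh xc; rewrite eqxx.
- rewrite /= exz has_cat negb_or nex.
  by apply/hasPn => b bc; have [_ ->] := cross _ _ xh bc; rewrite (negPf xnl).
apply: IH => // a b ac bc; apply: cross => //.
by rewrite inE ac orbT.
Qed.


Lemma split_last_has (a : pred T) c :
  has a c -> exists c1 z c2, [/\ c = c1 ++ z :: c2, a z & ~~ has a c2].
Proof.
elim: c => //= x c IH; have [/IH[c1 [z [c2 [-> az nc]]]] _|nc] := boolP (has a c).
  by exists (x :: c1), z, c2.
by rewrite orbF => ax; exists [::], x, c.
Qed.

(** Induct from the far end: once the tail is induced, either [x] lies on it and all before that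
    occurrence is dropped, or [x] is joined to its last neighbour on the tail. *)
Lemma walk_ipath x p :
  path e x p ->
  exists q, [/\ ipath e (x :: q), last x q = last x p & {subset q <= p}].
Proof.
elim: p x => [|y p IH] x /=; first by exists [::].
case/andP=> exy /IH[q [iq lq sq]].
have syq : {subset y :: q <= y :: p}.
  by move=> z; rewrite !inE => /orP[->//|/sq ->]; rewrite orbT.
have lyq : last x (y :: q) = last y p by [].
have [xq|xq] := boolP (x \in y :: q).
  move: iq syq lyq; case/splitPr: xq => c1 c2 /ipath_catr i2 s2.
  rewrite last_cat => l2; exists c2; split=> // z zc.
  by apply: s2; rewrite mem_cat inE zc !orbT.
have [|c1 [z [c2 [yqE exz nex]]]] := @split_last_has (e x) (y :: q).
  by rewrite /= exy.
rewrite yqE in iq syq lyq xq; exists (z :: c2); split.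
- apply/and3P; split; last exact: ipath_catr iq.
    by move: xq; rewrite mem_cat negb_or => /andP[].
  by rewrite exz nex.
- by rewrite -lyq last_cat.
by move=> w wc; apply: syq; rewrite mem_cat wc orbT.
Qed.

Lemma ipath_rev c : symmetric e -> ipath e c -> ipath e (rev c).
Proof.
move=> es; elim: c => //= x c IH ic; have {}IH : ipath e (rev c).
  by apply: IH; case/and3P: ic.
have xN : x \notin c by case/and3P: ic.
rewrite rev_cons; case: c ic IH xN => // y c ic.
case rE: (rev (y :: c)) => [|z w].
  by have := congr1 size rE; rewrite size_rev.
move=> iz xN; rewrite -cats1; apply: ipath_cat => // a b.
rewrite -rE mem_rev mem_seq1 => ac /eqP->; split; first by apply: contraNneq xN => <-.
rewrite es (@ipath_headE x y c a ic ac) eqxx andbT.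
by have := congr1 (last z) rE; rewrite rev_cons last_rcons /= => <-.
Qed.

Lemma ipath_adjacent c y z :
  symmetric e -> irreflexive e -> ipath e c -> y \in c -> z \in c -> e y z ->
  exists c1 c2, c = c1 ++ y :: z :: c2 \/ c = c1 ++ z :: y :: c2.
Proof.
move=> es ei; elim: c => //= x c IH pc.
have hd w : w \in c -> e x w -> exists c2, c = w :: c2.
  case: c pc {IH} => // v c pc wc.
  by rewrite (@ipath_headE x v c) // => /eqP->; exists c.
case/and3P: pc => xc _ /IH{}IH; rewrite !inE.
case/predU1P=> [->|yc] /predU1P[->|zc].
- by rewrite ei.
- by move=> exz; have [c2 ->] := hd z zc exz; exists [::], c2; left.
- by rewrite es => exy; have [c2 ->] := hd y yc exy; exists [::], c2; right.
move=> /(IH yc zc)[c1 [c2 [->|->]]]; exists (x :: c1), c2; by [left|right].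
Qed.

End InducedPaths.

Lemma ipath_map (T T' : eqType) (e : rel T) (e' : rel T') (f : T -> T') c :
  {in c &, injective f} -> {in c &, forall i j, e' (f i) (f j) = e i j} ->
  ipath e' (map f c) = ipath e c.
Proof.
elim: c => //= x c IH fi fe.
have xc : x \in x :: c by rewrite inE eqxx.
have sc : {subset c <= x :: c} by move=> w wc; rewrite inE wc orbT.
congr [&& _, _ & _].
- congr negb; apply/mapP/idP => [[y yc fxy]|xc']; last by exists x.
  by rewrite (fi x y xc (sc y yc) fxy).
- case: c {IH fi} fe sc xc => //= y c fe sc xc.
  rewrite fe ?inE ?eqxx ?orbT //; congr (_ && ~~ _).
  rewrite has_map; apply: eq_in_has => z zc /=.
  by rewrite fe // !inE zc !orbT.
by apply: IH => y z yc zc; [apply: fi|apply: fe]; apply: sc.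
Qed.

(** * Holes *)

Section Holes.

Variable G : sgraph.
Implicit Types (x y z : G) (c p q : seq G).

Lemma edge_neq x y : edge x y -> x != y.
Proof. by apply: contraTneq => ->; rewrite edge_irrefl. Qed.

Lemma next_second x y c : next (x :: y :: c) x = y.
Proof. by rewrite /= eqxx. Qed.

Lemma next_infix c1 c2 c y z : uniq c -> c = c1 ++ y :: z :: c2 -> next c y = z.
Proof.
move=> uc cE; rewrite -(next_rot (size c1) uc) cE rot_size_cat.
exact: next_second.
Qed.

(** An induced path has no chord, and [x] sees only its ends. [1 < size c] gives the path three
    vertices, hence the cycle four. *)
Lemma ipath_hole x y c :
  1 < size c -> ipath (@edge G) (y :: c) -> x \notin y :: c ->
  {in y :: c, forall z, edge x z = (z == y) || (z == last y c)} ->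
  is_hole (x :: y :: c).
Proof.
move=> sc pc xc ex; set h := x :: y :: c.
have uh : uniq h by rewrite /h /= xc; apply: (ipath_uniq pc).
have lc : last y c \in y :: c by apply: mem_last.
have nextx : next h x = y by apply: next_second.
(* Rotating [h] brings its last vertex to the front, followed by [x]. *)
have nextl : next h (last y c) = x.
  have hE : h = (x :: belast y c) ++ [:: last y c] by rewrite cats1 /= -lastI.
  rewrite -(next_rot (size (x :: belast y c)) uh) [in rot _ _]hE rot_size_cat.
  exact: next_second.
split.
- rewrite /is_cycle /ucycleb uh /= ltnS (ltnW _) //= andbT rcons_path.
  rewrite (ipath_path pc) ex ?mem_head // eqxx /=.
  by rewrite edge_sym ex // eqxx orbT.
- by rewrite /= !ltnS.
have nextc z w : z \in y :: c -> w \in y :: c -> edge z w ->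
    (w == next h z) || (z == next h w).
  move=> zc wc ezw.
  have hcat c1 u v c2 : y :: c = c1 ++ [:: u, v & c2] -> next h u = v.
    by move=> cE; apply: (next_infix (c1 := x :: c1) (c2 := c2) uh); rewrite /h cE.
  have [c1 [c2 [/hcat->|/hcat->]]] :=
    ipath_adjacent (@edge_sym G) (@edge_irrefl G) pc zc wc ezw.
    by rewrite eqxx.
  by rewrite eqxx orbT.
move=> z w; rewrite 2!(inE, in_cons x).
case/predU1P=> [->|zc] /predU1P[->|wc]; last exact: nextc.
- by rewrite edge_irrefl.
- rewrite ex // => /orP[]/eqP->; first by rewrite nextx eqxx.
  by rewrite nextl eqxx orbT.
rewrite edge_sym ex // => /orP[]/eqP->; first by rewrite nextx eqxx orbT.
by rewrite nextl eqxx.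
Qed.

End Holes.

(** * Words of attachments *)

Section Words.

Variables (D : seq nat) (adj : rel nat).

Fixpoint ipaths (n : nat) : seq (seq nat) :=
  if n is n'.+1 then
    flatten [seq [seq x :: c | x <- D &
      if c is y :: c' then
        if adj x y then (x \notin c) && ~~ has (adj x) c' else false
      else true] | c <- ipaths n']
  else [:: [::]].

Lemma ipathsP n c :
  c \in ipaths n -> [/\ size c = n, {subset c <= D} & ipath adj c].
Proof.
elim: n c => [|n IH] c /=; first by rewrite inE => /eqP->.
case/flatten_mapP=> c' /IH[sc Dc ic] /mapP[x].
rewrite mem_filter => /andP[ok xD ->]; split; first by rewrite /= sc.
  by move=> y; rewrite inE => /predU1P[->|/Dc].
case: c' ok ic {Dc sc} => [|y c'] //=.
by case: (adj x y) => // /andP[-> ->] ->.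
Qed.

Definition joins (s t : nat) (M c : seq nat) : bool :=
  if c is x :: c' then
    [&& x == s, last x c' == t & all (fun i => i \notin M) c]
  else false.

(* [Pe] and [Po] hold induced paths with an even and with an odd number of
   vertices.  An outside path attached at [t] and [s], whose inner attachments
   lie in [M], closes to an odd hole with one of the two paths found here,
   whatever its parity. *)
Definition blocked (Pe Po : seq (seq nat)) (s t : nat) (M : seq nat) : bool :=
  has (joins s t M) Pe && has (joins s t M) Po.

(** [w] is read away from a vertex attached at [x], and [M] collects the letters passed. Reading
    stops at [x], which would from then on be an inner attachment; so is any letter already in [M].
    Neither can end a path avoiding the inner attachments. *)
Fixpoint admissible Pe Po (x : nat) (M w : seq nat) : bool :=
  if w is t :: w' then
    (t == x) ||
    ((t \in M) || ~~ blocked Pe Po t x M) && admissible Pe Po x (t :: M) w'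
  else true.

Fixpoint firsts (w : seq nat) : seq nat :=
  if w is x :: w' then x :: [seq y <- firsts w' | y != x] else [::].

(** Words grow at the front. An outside path with two distinct end letters has at least two
    vertices, so with 4, 5 or 6 vertices of the copy the odd totals are at least 4 + 3, 5 + 2 and 6
    + 3. *)
Definition closed_words (R : seq (seq nat)) : bool :=
  let Pe := ipaths 4 ++ ipaths 6 in let Po := ipaths 5 in
  ([::] \in R) &&
  all (fun st => all (fun x => admissible Pe Po x [::] st ==>
                       ((x :: [seq y <- st | y != x]) \in R)) D) R.

Lemma mem_firsts w : firsts w =i w.
Proof.
elim: w => //= x w IH y; rewrite !inE mem_filter IH.
by case: (y == x).
Qed.

Lemma firsts_rcons w t : t \notin w -> firsts (rcons w t) = rcons (firsts w) t.
Proof.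
elim: w => //= x w IH; rewrite inE negb_or => /andP[tx /IH->].
by rewrite filter_rcons tx.
Qed.

Lemma eq_joins s t M M' : M =i M' -> joins s t M =1 joins s t M'.
Proof.
move=> MM [|x c] //=; rewrite MM; congr [&& _, _, _ & _].
by apply: eq_all => i; rewrite MM.
Qed.

Lemma eq_blocked Pe Po s t M M' :
  M =i M' -> blocked Pe Po s t M = blocked Pe Po s t M'.
Proof. by move=> MM; congr (_ && _); apply/eq_has/eq_joins. Qed.

Lemma eq_admissible Pe Po x M M' w :
  M =i M' -> admissible Pe Po x M w = admissible Pe Po x M' w.
Proof.
elim: w M M' => //= t w IH M M' MM; rewrite MM (eq_blocked _ _ _ _ MM).
by rewrite (IH _ (t :: M')) // => i; rewrite !inE MM.
Qed.

(** A letter of [M] other than [x] imposes no condition and adds nothing to [M]. *)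
Lemma admissible_filter Pe Po x M t w :
  t \in M -> t != x ->
  admissible Pe Po x M [seq y <- w | y != t] = admissible Pe Po x M w.
Proof.
move=> + tx; elim: w M => //= y w IH M tM; case: (eqVneq y t) => [->|yt] /=.
  rewrite IH // (negPf tx) tM /=; apply: eq_admissible => i.
  by rewrite inE; case: eqP => [->|].
by rewrite IH // inE tM orbT.
Qed.

Lemma admissible_firsts Pe Po x M w :
  admissible Pe Po x M (firsts w) = admissible Pe Po x M w.
Proof.
elim: w M => //= t w IH M; case: eqVneq => //= tx.
by rewrite admissible_filter ?IH // inE eqxx.
Qed.

End Words.

(** * Separation by vertex sets, and the consequences of girth 5 *)

(** A path avoiding [S] that starts in [a] never leaves [a]. *)
Lemma separated (G : sgraph) (S : {set G}) (a : pred G) (x y : G) :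
  a x -> ~~ a y -> x \notin S -> y \notin S ->
  (forall u w, edge u w -> a u -> w \notin S -> a w) ->
  ~ connected (induced (~: S)).
Proof.
move=> ax nay xS yS step conn.
have xC : x \in ~: S by rewrite inE.
have yC : y \in ~: S by rewrite inE.
have /connectP[p] := conn (exist _ x xC) (exist _ y yC).
have : a (val (exist (fun z => z \in ~: S) x xC)) by [].
elim: p (exist _ x xC) => [|w p IH] u au /=.
  by move=> _ uE; move: au nay; rewrite -uE => /= ->.
case/andP=> uw; apply: IH; apply: step uw au _.
by have := valP w; rewrite inE.
Qed.

Definition no_triangle (G : sgraph) :=
  forall a b c : G, edge a b -> edge a c -> edge b c -> False.

Definition no_square (G : sgraph) :=
  forall a b c d : G, a != c -> b != d ->
  edge a b -> edge b c -> edge c d -> edge d a -> False.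

Lemma girth5_no_triangle (G : sgraph) : has_girth G 5 -> no_triangle G.
Proof.
case=> _ g a b c ab ac bc; suff /g : is_cycle [:: a; b; c] by [].
rewrite /is_cycle /ucycleb /= ab bc edge_sym ac /= !inE negb_or.
by rewrite !edge_neq.
Qed.

Lemma girth5_no_square (G : sgraph) : has_girth G 5 -> no_square G.
Proof.
case=> _ g a b c d ac bd ab bc cd da.
suff /g : is_cycle [:: a; b; c; d] by [].
rewrite /is_cycle /ucycleb /= ab bc cd da /= !inE !negb_or ac bd.
by rewrite !edge_neq //= 1?edge_sym.
Qed.

(** * Attachments of an embedded graph *)

(** Numbers serve as labels so that questions about the embedded graph can be settled by
    computation; [f] is arbitrary off [D]. *)
Definition embeds (G : sgraph) (D : seq nat) (adj : rel nat) (f : nat -> G) :=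
  {in D &, injective f} /\
  {in D &, forall i j, edge (f i) (f j) = adj i j}.

Definition outside (G : sgraph) (D : seq nat) (f : nat -> G) : pred G :=
  fun x => x \notin map f D.

Definition single_touch (G : sgraph) (D : seq nat) (f : nat -> G) :=
  forall x i j, outside D f x -> i \in D -> j \in D ->
  edge x (f i) -> edge x (f j) -> i = j.

Section Attachments.

Variables (G : sgraph) (D : seq nat) (adj : rel nat) (f : nat -> G).
Hypothesis no_long : forall c : seq G, is_hole c -> odd (size c) -> size c < 7.
Hypothesis uniqD : uniq D.
Hypothesis embf : embeds D adj f.
Implicit Types (x y z : G) (p : seq G) (i j s t : nat) (w : seq nat).

Let out := outside D f.

Lemma outsideP x i : out x -> i \in D -> x != f i.
Proof. by move=> ox iD; apply: contraNneq ox => ->; apply: map_f. Qed.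

Lemma embed_ipath w : {subset w <= D} -> ipath (@edge G) (map f w) = ipath adj w.
Proof.
move=> wD; have [fi fe] := embf.
by apply: ipath_map => i j /wD iD /wD jD; [apply: fi|apply: fe].
Qed.

(** The hole is closed at [f s], the rest being the path from [f u] to [f (last u w)] continued by
    [y :: p]. If [p] is empty, [y] is attached at both ends. *)
Lemma bridge_hole s u w y p :
  ipath adj [:: s, u & w] -> {subset [:: s, u & w] <= D} -> w != [::] ->
  ipath (@edge G) (y :: p) -> all out (y :: p) ->
  {in y :: p & [:: s, u & w], forall z i, edge z (f i) =
     ((z == y) && (i == last u w)) || ((z == last y p) && (i == s))} ->
  is_hole (f s :: map f (u :: w) ++ y :: p).
Proof.
move=> iT TD w0 ip op ezi; have [fi fe] := embf.
have /andP[sN uT] := ipath_uniq iT.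
have sT : s \in [:: s, u & w] by rewrite inE eqxx.
have sub i : i \in u :: w -> i \in [:: s, u & w] by move=> iw; rewrite inE iw orbT.
have lT : last u w \in u :: w by apply: mem_last.
have os z i : z \in y :: p -> i \in [:: s, u & w] -> z != f i.
  by move=> zp /TD iD; apply: outsideP => //; apply: (allP op).
have ic : ipath (@edge G) (map f (u :: w) ++ y :: p).
  apply: ipath_cat => //.
    rewrite -[_ :: _]/(map f (u :: w)) embed_ipath; first by case/and3P: iT.
    by move=> i /sub/TD.
  rewrite -[f u :: _]/(map f (u :: w)) => a b /mapP[i iw ->] bp.
  rewrite eq_sym os ?sub //; split=> //.
  rewrite edge_sym ezi ?sub // (negPf (memPn sN i iw)) // andbF orbF andbC last_map.
  congr (_ && _); apply/eqP/eqP => [->//|/fi]; apply; exact/TD/sub.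
have sE i : i \in u :: w -> edge (f s) (f i) = (i == u).
  by move=> iw; rewrite (fe _ _ (TD _ sT) (TD _ (sub _ iw))) (ipath_headE iT).
apply: ipath_hole => //=.
- by rewrite size_cat size_map /= addnS ltnS ltn_addr // lt0n size_eq0.
- rewrite -[_ :: _ ++ _]/(map f (u :: w) ++ y :: p) mem_cat negb_or.
  apply/andP; split.
    apply/mapP => -[i iw /fi si]; move: (sN).
    by rewrite (si (TD _ sT) (TD _ (sub _ iw))) iw.
  by apply/negP => sp; have := os _ _ sp sT; rewrite eqxx.
move=> z; rewrite -[_ :: _ ++ _]/(map f (u :: w) ++ y :: p) mem_cat last_cat.
have uw : u \in u :: w by apply: mem_head.
case/orP=> [/mapP[i iw ->]|zp] /=.
  rewrite sE // (inj_in_eq fi (TD _ (sub _ iw)) (TD _ (sub _ uw))).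
  by rewrite [f i == _]eq_sym (negPf (os _ _ (mem_last y p) (sub i iw))) orbF.
rewrite edge_sym ezi // eqxx andbT (negPf (os _ _ zp (sub _ uw))) /=.
by rewrite [s == _]eq_sym (negPf (memPn sN _ lT)) andbF.
Qed.

Lemma bridge_short s u w y p :
  ipath adj [:: s, u & w] -> {subset [:: s, u & w] <= D} -> w != [::] ->
  ipath (@edge G) (y :: p) -> all out (y :: p) ->
  {in y :: p & [:: s, u & w], forall z i, edge z (f i) =
     ((z == y) && (i == last u w)) || ((z == last y p) && (i == s))} ->
  odd (size w + size p).+3 -> (size w + size p).+3 < 7.
Proof.
move=> iT TD w0 ip op ezi; have h := bridge_hole iT TD w0 ip op ezi.
have -> : (size w + size p).+3 = size (f s :: map f (u :: w) ++ y :: p).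
  by rewrite /= size_cat size_map /= addnS.
exact: no_long.
Qed.

Hypothesis single : single_touch D f.

Definition touch x : seq nat := [seq i <- D | edge x (f i)].

(** By [single] each vertex outside the copy contributes at most one letter. *)
Definition trace p : seq nat := flatten (map touch p).

Lemma mem_touch x i : (i \in touch x) = edge x (f i) && (i \in D).
Proof. by rewrite mem_filter. Qed.

Lemma mem_trace p i :
  reflect (exists2 x, x \in p & edge x (f i) && (i \in D)) (i \in trace p).
Proof.
by apply: (iffP flatten_mapP) => -[x xp xi]; exists x => //;
   rewrite mem_touch in xi *.
Qed.

Lemma trace_cat p q : trace (p ++ q) = trace p ++ trace q.
Proof. by rewrite /trace map_cat flatten_cat. Qed.

Lemma trace_cons x p : trace (x :: p) = touch x ++ trace p.
Proof. by []. Qed.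

Lemma touch_eq x i : out x -> i \in D -> edge x (f i) -> touch x = [:: i].
Proof.
move=> ox iD xi; have : uniq (touch x) by rewrite filter_uniq.
have : i \in touch x by rewrite mem_touch xi.
have ti j : j \in touch x -> j = i.
  by rewrite mem_touch => /andP[xj jD]; apply: (single ox).
case: (touch x) ti => [|j [|k w]] // ti; first by rewrite inE => /eqP->.
have jw : j \in [:: j, k & w] by rewrite in_cons eqxx.
have kw : k \in [:: j, k & w] by rewrite !in_cons eqxx orbT.
by rewrite (etrans (ti j jw) (esym (ti k kw))) => _ /andP[]; rewrite mem_head.
Qed.

Lemma touchP x : out x ->
  touch x = [::] \/ exists i, [/\ i \in D, edge x (f i) & touch x = [:: i]].
Proof.
move=> ox; case tx: (touch x) => [|i w]; first by left.
have : i \in touch x by rewrite tx mem_head.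
rewrite mem_touch => /andP[xi iD]; right; exists i; split=> //.
by rewrite -tx; apply: touch_eq.
Qed.

Lemma edge_touch x i : i \in D -> edge x (f i) = (i \in touch x).
Proof. by move=> iD; rewrite mem_touch iD andbT. Qed.

Lemma trace_rcons p x : trace (rcons p x) = trace p ++ touch x.
Proof. by rewrite -cats1 trace_cat /trace /= cats0. Qed.

Lemma joined_short (x t n : nat) (M c : seq nat) y u z :
  2 < n -> c \in ipaths D adj n -> joins t x M c ->
  ipath (@edge G) (y :: rcons u z) -> all out (y :: rcons u z) ->
  touch y = [:: x] -> touch z = [:: t] -> {subset trace u <= M} ->
  odd (n + (size u).+2) -> n + (size u).+2 < 7.
Proof.
move=> n2 /ipathsP[szc cD ic] jc ip op ty tz uM.
case: c szc cD ic jc => [|a [|b w]] szc cD ic; rewrite -szc // in n2 *.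
case/and3P=> /eqP aE /eqP lE nM; subst a.
have uyz := ipath_uniq ip.
move: (uyz); rewrite /= mem_rcons inE negb_or rcons_uniq.
case/andP=> /andP[yz yu] /andP[zu _].
rewrite -/(size [:: b & w]) /= !addnS !addSn => od.
have := @bridge_short t b w y (rcons u z) ic cD _ ip op _.
rewrite size_rcons !addnS; apply=> //; first by case: w n2 {szc cD ic lE nM od}.
move=> v i vp iT; have iD := cD _ iT; have iM := allP nM _ iT.
rewrite last_rcons edge_touch // -[last b w]/(last t (b :: w)) lE.
move: vp; rewrite inE mem_rcons inE => /or3P[/eqP->|/eqP->|vu].
- by rewrite ty inE eqxx (negPf yz) orbF.
- by rewrite tz inE eqxx eq_sym [z == y]eq_sym (negPf yz) /= eq_sym.
have vy : v != y by apply: contraNneq yu => <-.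
have vz : v != z by apply: contraNneq zu => <-.
rewrite (negPf vy) (negPf vz) /=; apply/negbTE; apply: contra iM => iv.
by apply: uM; apply/mem_trace; exists v; rewrite // -mem_touch.
Qed.

(** [u] is the part already read. If a new letter [t] were blocked with [x], the outside path
    between their vertices would close up with paths of the copy of both parities, and one of the
    two holes would be odd of length at least 7. *)
Lemma trace_admissible (x : nat) (M : seq nat) y u p :
  ipath (@edge G) (y :: u ++ p) -> all out (y :: u ++ p) ->
  touch y = [:: x] -> x \notin trace u -> M =i trace u ->
  admissible (ipaths D adj 4 ++ ipaths D adj 6) (ipaths D adj 5) x M (trace p).
Proof.
elim: p u M => // z p IH u M; rewrite -cat_rcons => ip op ty xu Mu.
rewrite trace_cons.
have oz : out z.
  by apply: (allP op); rewrite inE mem_cat mem_rcons inE eqxx !orbT.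
have [tz|[t [tD ezt tz]]] := touchP oz; rewrite tz.
  by apply: (IH (rcons u z)); rewrite // trace_rcons tz cats0.
rewrite [admissible _ _ _ _ _]/=; case: (eqVneq t x) => //= tx.
apply/andP; split; last first.
  apply: (IH (rcons u z)) => //.
    by rewrite trace_rcons tz mem_cat inE negb_or xu eq_sym.
  by move=> i; rewrite trace_rcons tz mem_cat !inE Mu orbC.
rewrite -implyNb; apply/implyP => _; apply/negP.
case/andP=> /hasP[c4 i4 j4] /hasP[c5 i5 j5].
move: ip op; rewrite -cat_cons => /ipath_catl ip.
rewrite all_cat => /andP[op _].
have uM : {subset trace u <= M} by move=> i; rewrite Mu.
have h4 : odd (4 + (size u).+2) -> 4 + (size u).+2 < 7.
  rewrite mem_cat in i4; case/orP: i4 => i4.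
    exact: (joined_short (n := 4) isT i4 j4 ip op ty tz uM).
  have h6 := joined_short (n := 6) isT i4 j4 ip op ty tz uM.
  by move: (size u) h6; clear=> n; lia.
have h5 := joined_short (n := 5) isT i5 j5 ip op ty tz uM.
by move: (size u) h4 h5; clear=> n; lia.
Qed.

Lemma trace_closed R p :
  closed_words D adj R -> ipath (@edge G) p -> all out p ->
  firsts (trace p) \in R.
Proof.
case/andP=> nR cR; elim: p => // x p IH ip /andP[ox op].
have ip' : ipath (@edge G) p by case/and3P: ip.
have [tx|[i [iD _ tx]]] := touchP ox; rewrite trace_cons tx; first exact: IH.
have /allP/(_ i iD)/implyP := allP cR _ (IH ip' op); apply.
rewrite admissible_firsts; apply: (@trace_admissible i [::] x [::]) => //=.
by rewrite ox.
Qed.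

(** * Components of the outside *)

Definition outside_edge : rel G := fun x y => [&& out x, out y & edge x y].

(** This depends only on the component of [x] in the graph left when the copy is deleted. *)
Definition attachments x : seq nat :=
  [seq i <- D | [exists y, connect outside_edge x y && edge y (f i)]].

Lemma attachmentsP x i :
  reflect (i \in D /\ exists2 y, connect outside_edge x y & edge y (f i))
          (i \in attachments x).
Proof.
rewrite mem_filter andbC; apply: (iffP andP) => -[iD].
  by case/existsP=> y /andP[]; split=> //; exists y.
by case=> y xy yi; split=> //; apply/existsP; exists y; rewrite xy.
Qed.

Lemma connect_outside_sym : connect_sym outside_edge.
Proof.
by apply: sym_connect_sym => x y; rewrite /outside_edge edge_sym andbCA.
Qed.

Lemma connect_outside x y : out x -> connect outside_edge x y -> out y.
Proof.
move=> ox /connectP[p pp ->] {y}; elim: p x ox pp => //= z p IH x _.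
by case/andP=> /and3P[_ oz _]; apply: IH.
Qed.

Lemma connect_attachments x y :
  connect outside_edge x y -> attachments x = attachments y.
Proof.
move=> xy; apply: eq_filter => i; apply: eq_existsb => z.
by rewrite (same_connect connect_outside_sym xy).
Qed.

(** Shorten a walk from [f s] through the component to [f t] to an induced path. Its ends are
    distinct and non-adjacent, so its interior is nonempty; it lies in the component. *)
Lemma connecting_path x s t :
  out x -> s \in attachments x -> t \in attachments x -> s != t ->
  ~~ adj s t ->
  exists y p, [/\ ipath (@edge G) (y :: p),
    {in y :: p, forall z, connect outside_edge x z},
    {in y :: p, forall z, edge z (f s) = (z == y)} &
    {in y :: p, forall z, edge z (f t) = (z == last y p)}].
Proof.
move=> ox /attachmentsP[sD [a xa as_]] /attachmentsP[tD [b xb bt]] st nst.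
have [fi fe] := embf.
have [w pw lw] : exists2 w, path outside_edge a w & b = last a w.
  apply/connectP; apply: connect_trans xb.
  by rewrite connect_outside_sym.
have wx : {in a :: w, forall z, connect outside_edge x z}.
  move=> z zw; apply: connect_trans xa _.
  exact: (path_connect pw).
have pfs : path (@edge G) (f s) (rcons (a :: w) (f t)).
  rewrite rcons_path /= edge_sym as_ -lw bt andbT /=.
  by apply: sub_path pw => c d /and3P[].
have [q [iq lq sq]] := walk_ipath pfs; rewrite last_rcons in lq.
have fst : f s != f t by apply: contraNneq st => /fi->.
have [q' qE] : exists q', q = rcons q' (f t).
  case/lastP: q lq {iq sq} => [/= fE|q' l]; first by rewrite fE eqxx in fst.
  by rewrite last_rcons => ->; exists q'.
case: q' qE => [|y p] qE; rewrite {q lq}qE in iq sq.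
  by case/and3P: iq => _; rewrite /= fe // (negPf nst).
exists y, p.
have up := ipath_uniq iq.
have yp z : z \in y :: p -> z \in a :: w.
  move=> zp; have := sq z; rewrite !mem_rcons !inE -in_cons zp orbT => /(_ isT).
  case/predU1P=> // zE; move: up.
  by rewrite cons_uniq rcons_uniq -zE zp andbF.
have ip : ipath (@edge G) (y :: rcons p (f t)) by case/and3P: iq.
split.
- by move: ip; rewrite -rcons_cons -cats1 => /ipath_catl.
- by move=> z /yp/wx.
- move=> z zp; rewrite edge_sym (ipath_headE iq) //.
  by rewrite -rcons_cons mem_rcons in_cons zp orbT.
by move=> z zp; apply: (ipath_lastE ip).
Qed.

Lemma connecting_trace R x s t :
  closed_words D adj R ->
  out x -> s \in attachments x -> t \in attachments x -> s != t ->
  ~~ adj s t ->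
  exists y p, [/\ ipath (@edge G) (y :: p),
    {in y :: p, forall z, connect outside_edge x z},
    {in y :: p, forall z, edge z (f s) = (z == y)},
    {in y :: p, forall z, edge z (f t) = (z == last y p)} &
    let st := firsts (trace (y :: p)) in
    [/\ st \in R, st =i trace (y :: p), {subset st <= attachments x},
        ohead st = Some s & ohead (rev st) = Some t]].
Proof.
move=> cR ox sx tx st nst.
have [y [p [ip xp es et]]] := connecting_path ox sx tx st nst.
exists y, p; split=> //.
have op : all out (y :: p) by apply/allP => z /xp; apply: connect_outside.
have /attachmentsP[sD _] := sx; have /attachmentsP[tD _] := tx.
have yh : y \in y :: p by apply: mem_head.
have lh : last y p \in y :: p by apply: mem_last.
split; first exact: trace_closed.
- exact: mem_firsts.
- move=> i; rewrite mem_firsts => /mem_trace[z zp /andP[zi iD]].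
  by apply/attachmentsP; split=> //; exists z; rewrite ?xp.
- by rewrite trace_cons (touch_eq (allP op _ yh) sD) //= es.
(* Only the last vertex is adjacent to [f t], so [t] first occurs at the end of the word. *)
rewrite lastI trace_rcons (touch_eq (allP op _ lh) tD) ?et //.
rewrite cats1 firsts_rcons ?rev_rcons //.
apply/mem_trace => -[z zb /andP[zt _]].
have := ipath_uniq ip; rewrite lastI rcons_uniq => /andP[/negP[]].
have zp : z \in y :: p by rewrite lastI mem_rcons inE zb orbT.
by rewrite -(eqP (etrans (esym (et z zp)) zt)).
Qed.

Lemma attachments_separate x b :
  out x -> b \in D -> b \notin attachments x ->
  ~ connected (induced (~: [set y in map f (attachments x)])).
Proof.
move=> ox bD nb; have [fi _] := embf.
apply: (@separated G _ (connect outside_edge x) x (f b)).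
- by [].
- by apply/negP => /(connect_outside ox); rewrite /out /outside map_f.
- rewrite inE; apply/mapP => -[i /attachmentsP[iD _] xE].
  by have := outsideP ox iD; rewrite xE eqxx.
- rewrite inE; apply/mapP => -[i ib /fi bi]; move: nb.
  by rewrite bi ?ib //; case/attachmentsP: ib.
move=> u w uw xu wS; apply: (connect_trans xu); apply: connect1.
rewrite /outside_edge uw (connect_outside ox xu) andbT /=.
apply: contra wS => /mapP[i iD wE]; rewrite inE wE map_f //.
by apply/attachmentsP; split=> //; exists u; rewrite -?wE.
Qed.

(** * Use of 3-connectivity and of the condition on 3-cutsets *)

Hypothesis conn3 : k_connected 3 G.

(** Otherwise the at most two neighbours of [f i] in the copy separate it from [f j]. *)
Lemma outside_neighbor i j :
  i \in D -> j \in D -> j != i -> ~~ adj i j ->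
  size [seq k <- D | adj i k] < 3 -> exists2 x, out x & edge x (f i).
Proof.
move=> iD jD ji nij sz; have [fi fe] := embf.
have [/existsP[x /andP[ox xi]]|] := boolP [exists x, out x && edge x (f i)].
  by exists x.
rewrite negb_exists => /forallP noout; exfalso.
set S := [set y in map f [seq k <- D | adj i k]].
have [_ /(_ S)] := conn3.
have -> : #|S| < 3.
  by rewrite cardsE (leq_ltn_trans (card_size _)) // size_map.
move=> /(_ isT); apply: (@separated G S (pred1 (f i)) (f i) (f j)) => //=.
- by apply: contra ji => /eqP/fi->.
- rewrite inE; apply/mapP => -[k]; rewrite mem_filter => /andP[ik kD] /fi ik'.
  by move: ik; rewrite -ik' // -(fe i i) // edge_irrefl.
- rewrite inE; apply/mapP => -[k]; rewrite mem_filter => /andP[ik kD] /fi jk.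
  by move: nij; rewrite jk // ik.
move=> u w uw /eqP uE wS; move: (noout w); rewrite edge_sym -uE uw andbT negbK.
case/mapP=> k kD wE; move: wS; rewrite inE wE map_f // mem_filter kD andbT.
by rewrite -fe // -uE -wE.
Qed.

Hypothesis cut3 : forall S : {set G}, k_cutset 3 S -> stable S.

(** With fewer than four attachments some label is left over, and they separate it from the
    component of [x]. Two or fewer contradict 3-connectivity; three form a 3-cutset, hence a stable
    set. *)
Lemma attachments_large x :
  out x -> 3 < size D ->
  2 < size (attachments x) /\
  (size (attachments x) = 3 ->
   {in attachments x &, forall i j, ~~ adj i j}).
Proof.
move=> ox D3; have [fi fe] := embf.
have sub : {subset attachments x <= D} by move=> i /attachmentsP[].
have ua : uniq (attachments x) by rewrite filter_uniq.
set S := [set y in map f (attachments x)].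
have cS : #|S| = size (attachments x).
  rewrite cardsE -(size_map f); apply/card_uniqP.
  by rewrite map_inj_in_uniq // => i j /sub iD /sub jD; apply: fi.
have sep : size (attachments x) < 4 -> ~ connected (induced (~: S)).
  move=> s4; have [/hasP[b bD nb]|] := boolP (has [predC attachments x] D).
    exact: attachments_separate bD nb.
  move/hasPn => Da; have le : size D <= size (attachments x).
    by apply: uniq_leq_size => // i /Da/negbNE.
  by have := leq_trans D3 le; rewrite leqNgt s4.
split.
  rewrite ltnNge; apply/negP => s2; apply: sep; first by rewrite ltnS leqW.
  by have [_] := conn3; apply; rewrite cS ltnS.
move=> s3 i j ia ja; rewrite -fe ?sub //.
have /cut3 st : k_cutset 3 S by split; rewrite ?cS //; apply: sep; rewrite s3.
by apply: st; rewrite inE map_f.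
Qed.

(** Two non-adjacent attachments would occur in one word of [R], which is a clique. So the
    attachments are pairwise adjacent, and three of them form a triangle. *)
Lemma rigid_spanning R x :
  no_triangle G -> 3 < size D -> closed_words D adj R ->
  all (fun st => all (fun s => all (fun t => [|| s == t, adj s t | adj t s]) st) st) R ->
  out x -> False.
Proof.
move=> tri D3 cR clique ox; have [fi fe] := embf.
have [sz _] := attachments_large ox D3.
have sub : {subset attachments x <= D} by move=> i /attachmentsP[].
have ua : uniq (attachments x) by rewrite filter_uniq.
have adja s t : s \in attachments x -> t \in attachments x -> s != t ->
    edge (f s) (f t).
  move=> sx tx st; rewrite fe ?sub //; apply/negPn/negP => nst.
  have [y [p [_ _ _ _ /= [stR _ _ hs ht]]]] := connecting_trace cR ox sx tx st nst.
  move: (firsts _) stR hs ht => w stR hs ht.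
  have mem_ohead (v : seq nat) k : ohead v = Some k -> k \in v.
    by case: v => //= _ v [->]; apply: mem_head.
  have sw := mem_ohead _ _ hs; have tw := mem_ohead _ _ ht; rewrite mem_rev in tw.
  have /allP/(_ s sw)/allP/(_ t tw) := allP clique _ stR.
  by rewrite -(fe t s) ?sub // edge_sym fe ?sub // (negPf st) (negPf nst).
case: (attachments x) sz ua adja => [|a [|b [|c w]]] // _ /= ua adja.
have /and3P[+ + _] := ua; rewrite !inE !negb_or => /and3P[ab ac _] /andP[bc _].
by apply: (tri (f a) (f b) (f c)); apply: adja; rewrite // !inE eqxx ?orbT.
Qed.

End Attachments.

(** * Vertices with several attachments *)

(** For distinct labels: distance at least three in the labelled graph. *)
Definition far (D : seq nat) (adj : rel nat) (i j : nat) : bool :=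
  ~~ adj i j && ~~ has (fun k => adj i k && adj k j) D.

Fixpoint far_sets (D : seq nat) (adj : rel nat) (E : seq nat) : seq (seq nat) :=
  if E is i :: E' then
    let r := far_sets D adj E' in
    r ++ [seq i :: c | c <- r & all (far D adj i) c]
  else [:: [::]].

Definition extends (D : seq nat) (adj : rel nat) (k : nat) (c : seq nat)
    (adj' : rel nat) : bool :=
  [&& k \notin D, ~~ adj' k k,
      all (fun i => (adj' k i == (i \in c)) && (adj' i k == (i \in c))) D &
      all (fun i => all (fun j => adj' i j == adj i j) D) D].

Section Touch.

Variables (G : sgraph) (D : seq nat) (adj : rel nat) (f : nat -> G).
Hypotheses (uniqD : uniq D) (embf : embeds D adj f).
Hypotheses (tri : no_triangle G) (square : no_square G).

(** Adjacent attachments would form a triangle with [x], and two with a common neighbour a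
    square. *)
Lemma touch_far x : outside D f x -> touch D f x \in far_sets D adj D.
Proof.
move=> ox; have [fi fe] := embf.
have farx i j : i \in D -> j \in D -> i != j ->
    edge x (f i) -> edge x (f j) -> far D adj i j.
  move=> iD jD ij xi xj; apply/andP; split.
    by apply/negP; rewrite -fe // => eij; apply: (tri xi xj eij).
  apply/hasPn => k kD; rewrite -!fe //; apply/negP => /andP[ik kj].
  apply: (@square x (f i) (f k) (f j)); rewrite // ?[edge (f j) _]edge_sym //.
    exact: outsideP kD.
  by apply: contra ij => /eqP/fi->.
(* The induction shortens the list [E], while [far] keeps referring to all of [D]. *)
suff gen E : uniq E -> {subset E <= D} ->
    [seq i <- E | edge x (f i)] \in far_sets D adj E by apply: gen.
elim: E => //= i E IH /andP[iE uE] ED.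
have iD : i \in D by apply: ED; rewrite mem_head.
have {}IH : [seq k <- E | edge x (f k)] \in far_sets D adj E.
  by apply: IH => // k kE; apply: ED; rewrite inE kE orbT.
rewrite mem_cat; case: ifP => [xi|_]; last by rewrite IH.
rewrite orbC map_f // mem_filter IH andbT; apply/allP => j.
rewrite mem_filter => /andP[xj jE]; apply: farx => //.
  by apply: ED; rewrite inE jE orbT.
by apply: contraNneq iE => ->.
Qed.

Lemma embeds_extend x k (adj' : rel nat) :
  outside D f x -> extends D adj k (touch D f x) adj' ->
  embeds (k :: D) adj' (fun i => if i == k then x else f i).
Proof.
move=> ox /and4P[kD nkk /allP kE /allP dE]; have [fi fe] := embf.
have nk i : i \in D -> (i == k) = false.
  by move=> iD; apply: contraNF kD => /eqP<-.
have xk i : i \in D -> edge x (f i) = adj' k i.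
  by move=> iD; have /andP[/eqP-> _] := kE i iD; rewrite mem_filter iD andbT.
split=> i j; rewrite !inE => /predU1P[->|iD] /predU1P[->|jD]; rewrite ?eqxx ?nk //.
- by move=> xE; move: ox; rewrite /outside xE map_f.
- by move=> xE; move: ox; rewrite /outside -xE map_f.
- exact: fi.
- by rewrite edge_irrefl (negPf nkk).
- exact: xk.
- have /andP[_ /eqP->] := kE i iD.
  by rewrite edge_sym mem_filter iD andbT.
by rewrite fe //; have /allP/(_ j jD)/eqP-> := dE i iD.
Qed.

Lemma touch_single :
  (forall x, outside D f x -> size (touch D f x) < 2) -> single_touch D f.
Proof.
move=> sz x i j ox iD jD xi xj; have := sz x ox.
have : i \in touch D f x by rewrite mem_filter xi.
have : j \in touch D f x by rewrite mem_filter xj.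
by case: (touch D f x) => [|k [|]] //; rewrite !inE => /eqP-> /eqP->.
Qed.

(* An outside vertex attached at the ends of an induced path with six vertices,
   and nowhere else, completes it to a hole of length 7. *)
Definition double_touch_bad (c : seq nat) : bool :=
  if c is [:: i; j] then has (joins i j [::]) (ipaths D adj 6) else size c < 2.

Lemma far_sets_single :
  (forall c : seq G, is_hole c -> odd (size c) -> size c < 7) ->
  all double_touch_bad (far_sets D adj D) -> single_touch D f.
Proof.
move=> no_long /allP bad; apply: touch_single => x ox.
have := bad _ (touch_far ox); case tE: (touch D f x) => [|i [|j [|]]] //.
case/hasP=> c /ipathsP[sc Dc ic] jc.
case: c sc Dc ic jc => [|a [|b w]] //= [sw] Dc ic /and3P[/eqP aE /eqP lE _].
have w0 : w != [::] by case: (w) sw.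
have := @bridge_short G D adj f no_long embf a b w x [::] ic Dc w0 isT.
rewrite sw /= andbT => /(_ ox) short; suff: 7 < 7 by []; apply: short => //.
move=> z k; rewrite inE => /eqP-> kc; rewrite eqxx lE aE /=.
by rewrite (edge_touch f x (Dc _ kc)) tE !inE orbC.
Qed.

End Touch.

Lemma embeds_eq_mem (G : sgraph) (D D' : seq nat) (adj : rel nat) (f : nat -> G) :
  embeds D adj f -> D =i D' -> embeds D' adj f.
Proof.
move=> [fi fe] DD; split=> i j; rewrite -!DD; [exact: fi|exact: fe].
Qed.

(** * The Petersen graph and three of its subgraphs *)

(* The labels 0, ..., 7 are the vertices of theta_plus; deleting the adjacent
   vertices 8 and 9 from the Petersen graph leaves theta_plus. *)
Definition padj : rel nat := fun i j =>
  j \in nth [::] [:: [:: 1; 4; 7]; [:: 0; 2; 8]; [:: 1; 3; 6]; [:: 2; 4; 9];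
    [:: 0; 3; 5]; [:: 4; 6; 8]; [:: 2; 5; 7]; [:: 0; 6; 9]; [:: 1; 5; 9];
    [:: 3; 7; 8]] i.

Definition padj_del (e : nat * nat) : rel nat := fun i j =>
  [&& padj i j, (i, j) != e & (j, i) != e].

(** The edges at 8 or 9: a vertex in the place of 8 or 9 that has only two of its three attachments
    leaves one of these edges missing. *)
Definition deleted_edges : seq (nat * nat) :=
  [:: (9, 3); (9, 7); (9, 8); (8, 1); (8, 5)].

Definition edge_words (D : seq nat) (adj : rel nat) : seq (seq nat) :=
  [::] :: [seq [:: s] | s <- D] ++
  [seq st <- [seq [:: s; t] | s <- D, t <- D] | ipath adj st].

Section Main.

Variable G : sgraph.
Hypothesis conn3 : k_connected 3 G.
Hypothesis girth5 : has_girth G 5.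
Hypothesis no_long : forall c : seq G, is_hole c -> odd (size c) -> size c < 7.
Hypothesis cut3 : forall S : {set G}, k_cutset 3 S -> stable S.

Let tri : no_triangle G := girth5_no_triangle girth5.
Let square : no_square G := girth5_no_square girth5.

Definition has_degree2 (D : seq nat) (adj : rel nat) : bool :=
  has (fun i => has (fun j =>
    [&& j != i, ~~ adj i j & size [seq k <- D | adj i k] < 3]) D) D.

Lemma degree2_outside (D : seq nat) (adj : rel nat) (f : nat -> G) :
  embeds D adj f -> has_degree2 D adj -> exists x, outside D f x.
Proof.
move=> ef /hasP[i iD /hasP[j jD /and3P[ji nij sz]]].
by have [x ox _] := outside_neighbor ef conn3 iD jD ji nij sz; exists x.
Qed.

Definition rigid (D : seq nat) (adj : rel nat) : bool :=
  [&& uniq D, 3 < size D & closed_words D adj (edge_words D adj)].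

Lemma rigid_no_outside (D : seq nat) (adj : rel nat) (f : nat -> G) x :
  rigid D adj -> embeds D adj f -> single_touch D f -> ~ outside D f x.
Proof.
case/and3P=> uD D3 cR ef single ox.
apply: (rigid_spanning no_long uD ef single conn3 cut3 tri D3 cR _ ox).
apply/allP => st; rewrite inE mem_cat => /or3P[/eqP->//|/mapP[s _ ->]|].
  by rewrite /= eqxx.
rewrite mem_filter => /andP[ist /allpairsP[[s t] /= [_ _ stE]]].
move: ist; rewrite stE /= !eqxx !andbT => /andP[_ est].
by rewrite est !orbT.
Qed.

(** The Petersen graph has diameter two, so no outside vertex has two attachments. *)
Lemma petersen_spanning (f : nat -> G) x :
  embeds (iota 0 10) padj f -> ~ outside (iota 0 10) f x.
Proof.
have chk : rigid (iota 0 10) padj &&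
    all (double_touch_bad (iota 0 10) padj) (far_sets (iota 0 10) padj (iota 0 10)).
  by vm_compute.
move: (iota 0 10) chk => D /andP[rD bad] ef; have [uD _ _] := and3P rD.
exact: rigid_no_outside rD ef (far_sets_single uD ef tri square no_long bad).
Qed.

(** The ends of the deleted edge have degree two, which forces an outside vertex, and rigidity
    forbids one. Labels at distance at least three are ends of an induced path on six vertices,
    whence [single_touch]. *)
Lemma no_petersen_del (f : nat -> G) e :
  e \in deleted_edges -> ~ embeds (iota 0 10) (padj_del e) f.
Proof.
have chk : all (fun e => [&& rigid (iota 0 10) (padj_del e),
    has_degree2 (iota 0 10) (padj_del e) &
    all (double_touch_bad (iota 0 10) (padj_del e))
        (far_sets (iota 0 10) (padj_del e) (iota 0 10))]) deleted_edges.
  by vm_compute.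
move: (iota 0 10) chk => D /allP chk /chk/and3P[rD d2 bad] ef.
have [uD _ _] := and3P rD; have [x] := degree2_outside ef d2.
exact: rigid_no_outside rD ef (far_sets_single uD ef tri square no_long bad).
Qed.

Hypothesis no_petersen : forall f : nat -> G, ~ embeds (iota 0 10) padj f.

(* An outside vertex with two attachments completes the graph either to the
   Petersen graph or to the Petersen graph minus an edge. *)
Lemma no_petersen_minus_vertex (D : seq nat) (f : nat -> G) :
  D \in [:: 8 :: iota 0 8; 9 :: iota 0 8] -> ~ embeds D padj f.
Proof.
set Ds := [:: _; _]; pose completes (D c : seq nat) :=
  (size c < 2) || has (fun k =>
    perm_eq (k :: D) (iota 0 10) && (extends D padj k c padj ||
    has (fun e => extends D padj k c (padj_del e)) deleted_edges)) [:: 8; 9].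
have chk : all (fun D => [&& rigid D padj, has_degree2 D padj &
    all (completes D) (far_sets D padj D)]) Ds by vm_compute.
move: Ds chk => Ds /allP chk /chk/and3P[rD d2 /allP bad] ef.
have [uD _ _] := and3P rD.
have single : single_touch D f.
  apply: touch_single => x ox; rewrite ltnNge; apply/negP => sz.
  have /orP[|/hasP[k _ /andP[/perm_mem kD]]] := bad _ (touch_far uD ef tri square ox).
    by rewrite ltnNge sz.
  case/orP=> [|/hasP[e eE]] /(embeds_extend ef ox)/embeds_eq_mem/(_ kD).
    exact: no_petersen.
  exact: no_petersen_del.
have [x ox] := degree2_outside ef d2; exact: rigid_no_outside rD ef single ox.
Qed.

(** * The graph theta_plus *)

(** The number of vertices is odd, as [size p] leaves out [y]. Attachments at [m] are unrestricted;
    the only others are [s] at the first vertex and [t] at the last. *)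
Definition bridge (D : seq nat) (f : nat -> G) (x : G) (s t m : nat) : Prop :=
  exists y p, [/\ ipath (@edge G) (y :: p),
    {in y :: p, forall z, connect (outside_edge D f) x z}, ~~ odd (size p) &
    {in y :: p & D, forall z i, i != m ->
      edge z (f i) = ((z == y) && (i == s)) || ((z == last y p) && (i == t))}].

Lemma bridge_sym D f x s t m : bridge D f x s t m -> bridge D f x t s m.
Proof.
case=> y [p [ip xp ep sp]].
have := ipath_rev (@edge_sym G) ip; rewrite [y :: p]lastI rev_rcons.
set y' := last y p; set p' := rev (belast y p) => ip'.
have pE : y' :: p' =i y :: p by move=> z; rewrite -rev_rcons -lastI mem_rev.
exists y', p'; split=> //.
- by move=> z; rewrite pE; apply: xp.
- by rewrite size_rev size_belast.
move=> z i; rewrite pE => zp iD im; rewrite sp // orbC; congr (_ || _ && _).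
have : y' :: p' = rev (y :: p) by rewrite [y :: p]lastI rev_rcons.
by move/(congr1 (last y)); rewrite rev_cons last_rcons /= => ->.
Qed.

Definition starts_ends (s t : nat) (w : seq nat) : bool :=
  (ohead w == Some s) && (ohead (rev w) == Some t).

Definition forces_bridge (D : seq nat) (R : seq (seq nat)) (A : seq nat)
    (s t m : nat) : bool :=
  [&& s \in A, t \in A, s != t, ~~ padj s t,
      all (fun w => starts_ends s t w && all [in A] w ==> all [in [:: s; m; t]] w) R &
      has (joins t s [:: m]) (ipaths D padj 5)].

(** The possible words leave a connecting path no inner attachment but [m]. If it had an even number
    of vertices, the five-vertex path of the copy would close it to an odd hole of length at least
    7. *)
Lemma attachments_bridge D R f x s t m :
  uniq D -> embeds D padj f -> single_touch D f -> closed_words D padj R ->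
  outside D f x -> forces_bridge D R (attachments D f x) s t m ->
  bridge D f x s t m.
Proof.
move=> uD ef single cR ox /and5P[sA tA st nst /andP[/allP Rm q5]].
have [y [p [ip xp es et /= [wR wE wA hs ht]]]] :=
  connecting_trace no_long uD ef single cR ox sA tA st nst.
have sm : {in y :: p & D, forall z i, i != m ->
    edge z (f i) = ((z == y) && (i == s)) || ((z == last y p) && (i == t))}.
  move=> z i zp iD im.
  have [->|is_] := eqVneq i s; first by rewrite es // andbT (negPf st) andbF orbF.
  have [->|it] := eqVneq i t; first by rewrite et // andbF andbT.
  rewrite !andbF; apply/negP => zi.
  have iw : i \in firsts (trace D f (y :: p)).
    by rewrite wE; apply/mem_trace; exists z; rewrite ?zi.
  have /implyP := Rm _ wR; rewrite /starts_ends hs ht !eqxx.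
  have -> : all [in attachments D f x] (firsts (trace D f (y :: p))).
    by apply/allP => k /wA.
  move=> /(_ isT)/allP/(_ _ iw); rewrite !inE.
  by rewrite (negPf is_) (negPf im) (negPf it).
exists y, p; split=> //.
case/hasP: q5 => c /ipathsP[sc Dc ic] jc.
case: c sc Dc ic jc => [|a [|b w]] //= [sw] Dc ic /and3P[/eqP aE /eqP lE nM].
have w0 : w != [::] by case: (w) sw.
have op : all (outside D f) (y :: p).
  by apply/allP => z /xp; apply: connect_outside.
rewrite {a}aE in Dc ic nM.
have := bridge_short no_long ef ic Dc w0 ip op.
rewrite sw lE => short; apply/negP => od.
suff : (3 + size p).+3 < 7 by move: (size p) od; clear=> n; lia.
apply: short; last by move: (size p) od; clear=> n; lia.
move=> z i zp ic'; rewrite (sm z i zp (Dc i ic')) //.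
have /allP nM' : all (fun i => i \notin [:: m]) [:: t, b & w] by [].
by have := nM' i ic'; rewrite inE.
Qed.

(** The hole runs from [f e] along one bridge to [f s], over four vertices of the copy to [f t], and
    back along the other bridge. Bridges in different components have no edges between them, and 1 +
    odd + 4 + odd is odd and at least 7. *)
Lemma two_bridges D f x x' e s t m m' :
  uniq D -> embeds D padj f -> outside D f x -> outside D f x' ->
  ~~ connect (outside_edge D f) x x' ->
  bridge D f x e s m -> bridge D f x' t e m' ->
  e \in D -> e != m -> e != m' ->
  has (fun q => joins s t [:: e; m; m'] q && all (fun i => ~~ padj e i) q)
      (ipaths D padj 4) -> False.
Proof.
move=> uD ef ox ox' nxx' [y [p [ip xp evp sp]]] [y' [p' [ip' xp' evp' sp']]].
move=> eD em em' /hasP[c /ipathsP[sc Dc ic] /andP[jc /allP ne]].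
case: c sc Dc ic jc ne => [|a w] //= [sw] Dc ic /and3P[/eqP aE /eqP lE nM] ne.
have {nM}/allP nM : all (fun i => i \notin [:: e; m; m']) (a :: w) by [].
have [fi fe] := ef; rewrite {a}aE in Dc ic lE nM ne *.
have nMi i : i \in s :: w -> [/\ i != e, i != m & i != m'].
  by move/nM; rewrite !inE !negb_or => /and3P.
have out z : z \in y :: p -> outside D f z.
  by move/xp; apply: connect_outside.
have out' z : z \in y' :: p' -> outside D f z.
  by move/xp'; apply: connect_outside.
have apart a b : a \in y :: p -> b \in y' :: p' -> (a != b) && ~~ edge a b.
  move=> ap bp; apply/andP; split.
    apply: contraNneq nxx' => ab; apply: connect_trans (xp _ ap) _.
    by rewrite ab connect_outside_sym xp'.
  apply: contra nxx' => ab; apply: connect_trans (xp _ ap) _.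
  apply: (@connect_trans _ _ b); last by rewrite connect_outside_sym xp'.
  by apply: connect1; rewrite /outside_edge out // out'.
have yp : y \in y :: p by apply: mem_head.
have lp : last y p \in y :: p by apply: mem_last.
have lp' : last y' p' \in y' :: p' by apply: mem_last.
have sq : s \in s :: w by apply: mem_head.
have notf z i : outside D f z -> i \in D -> z != f i by apply: outsideP.
have tq : t \in s :: w by rewrite -lE mem_last.
have iq : ipath (@edge G) (map f (s :: w)) by rewrite (embed_ipath ef).
have icq : ipath (@edge G) (f s :: map f w ++ y' :: p').
  apply: ipath_cat => // a b; rewrite -[f s :: _]/(map f (s :: w)).
  case/mapP=> i iw -> bp; have [ie im imm] := nMi i iw; have iD := Dc i iw.
  rewrite eq_sym notf ?out' //; split=> //; rewrite edge_sym sp' //.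
  rewrite (negPf ie) andbF orbF last_map lE andbC; congr andb.
  by rewrite (inj_in_eq fi) ?Dc.
have icc : ipath (@edge G) (y :: p ++ f s :: map f w ++ y' :: p').
  apply: ipath_cat => // a b ap; rewrite -[f s :: _]/(map f (s :: w) ++ y' :: p').
  rewrite mem_cat => /orP[/mapP[i iw ->]|bp].
    have [ie im imm] := nMi i iw; have iD := Dc i iw.
    rewrite notf ?out // sp // (negPf ie) andbF orFb; split=> //.
    by rewrite (inj_in_eq fi) ?Dc.
  have /andP[ab nab] := apart _ _ ap bp; split=> //.
  by rewrite (negPf nab) [b == _](negPf (notf _ _ (out' _ bp) (Dc _ sq))) andbF.
have es i : i \in s :: w -> (e == i) = false.
  by move=> /nMi[ie _ _]; rewrite eq_sym (negPf ie).
have hole : is_hole (f e :: y :: p ++ f s :: map f w ++ y' :: p').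
  apply: ipath_hole => //.
  - by rewrite size_cat /= size_cat /= !addnS.
  - rewrite -[y :: _]/((y :: p) ++ map f (s :: w) ++ y' :: p') !mem_cat.
    apply/norP; split; last (apply/norP; split).
    + by apply/negP => fp; have := out _ fp; rewrite /outside map_f.
    + apply/mapP => -[i iw /(fi _ _ eD (Dc _ iw)) ei].
      by have := es i iw; rewrite ei eqxx.
    + by apply/negP => fp; have := out' _ fp; rewrite /outside map_f.
  move=> z; rewrite -[y :: _]/((y :: p) ++ map f (s :: w) ++ y' :: p') !mem_cat.
  rewrite (_ : last y _ = last y' p'); last by rewrite last_cat /= last_cat.
  case/or3P=> [zp|/mapP[i iw ->]|zp].
  - have /andP[zl _] := apart _ _ zp lp'.
    by rewrite edge_sym sp // eqxx es // !andbF andbT orbF (negPf zl) orbF.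
  - rewrite (fe _ _ eD (Dc _ iw)) (negPf (ne _ iw)).
    have oy := out _ yp; have ol := out' _ lp'.
    rewrite eq_sym (negPf (notf _ _ oy (Dc _ iw))).
    by rewrite eq_sym (negPf (notf _ _ ol (Dc _ iw))).
  have /andP[yz _] := apart _ _ yp zp.
  by rewrite edge_sym sp' // eqxx es // andbF orFb andbT [z == y]eq_sym (negPf yz).
have := no_long hole; rewrite /= size_cat /= size_cat /= size_map sw.
by move: (size p) (size p') evp evp'; clear=> a b; lia.
Qed.

(** * Words and attachment sets around [theta_plus] *)

Definition theta_labels : seq nat := iota 0 8.

(* The least family containing the empty word and closed in the sense of
   [closed_words], reached by iteration. *)
Definition theta_words : seq (seq nat) := Eval vm_compute in
  let Pe := ipaths theta_labels padj 4 ++ ipaths theta_labels padj 6 in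
  let Po := ipaths theta_labels padj 5 in
  iter 10 (fun R => undup (R ++ flatten [seq [seq x :: [seq y <- w | y != x] |
    x <- theta_labels & admissible Pe Po x [::] w] | w <- R])) [:: [::]].

Fixpoint sublists (E : seq nat) : seq (seq nat) :=
  if E is i :: E' then
    let r := sublists E' in r ++ [seq i :: c | c <- r]
  else [:: [::]].

Lemma filter_sublists a E : [seq i <- E | a i] \in sublists E.
Proof.
elim: E => //= i E IH; rewrite mem_cat.
by case: (a i); rewrite ?IH // map_f ?orbT.
Qed.

Definition linkable (R : seq (seq nat)) (A : seq nat) : bool :=
  all (fun s => all (fun t => [|| s == t, padj s t |
    has (fun w => starts_ends s t w && all [in A] w) R]) A) A.

Definition theta_attachments : seq (seq nat) :=
  [:: [:: 0; 1; 3; 4]; [:: 0; 4; 5; 7]; [:: 1; 2; 6; 7]; [:: 2; 3; 5; 6]].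

(** A search through all 256 sets of labels. The conditions are those of attachment sets: a word
    between any two non-adjacent members, at least three members, and stability if there are exactly
    three. *)
Lemma linkable_theta_attachments :
  all (fun A => [==> linkable theta_words A, 2 < size A,
    (size A == 3) ==> all (fun i => all (fun j => ~~ padj i j) A) A =>
    A \in theta_attachments]) (sublists theta_labels).
Proof. by vm_compute. Qed.

Lemma theta_closed : closed_words theta_labels padj theta_words.
Proof. by vm_compute. Qed.

Section Theta.

Variable f : nat -> G.
Hypothesis ef : embeds theta_labels padj f.

(** Labels at distance at least three turn out to be the attachments of 8 or of 9, so such a vertex
    would give the Petersen graph minus a vertex. *)
Lemma theta_single : single_touch theta_labels f.
Proof.
have uD : uniq theta_labels by [].
apply: touch_single => x ox; rewrite ltnNge; apply/negP => sz.
have chk : all (fun c => (size c < 2) ||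
    has (fun k => extends theta_labels padj k c padj) [:: 8; 9])
  (far_sets theta_labels padj theta_labels) by vm_compute.
have /orP[|/hasP[k k89]] := allP chk _ (touch_far uD ef tri square ox).
  by rewrite ltnNge sz.
move/(embeds_extend ef ox); apply: no_petersen_minus_vertex.
by move: k89; rewrite !inE => /orP[]/eqP->; rewrite eqxx ?orbT.
Qed.

Lemma theta_attachmentsE x :
  outside theta_labels f x -> attachments theta_labels f x \in theta_attachments.
Proof.
move: theta_closed theta_single ef linkable_theta_attachments.
have : 3 < size theta_labels by []; have : uniq theta_labels by [].
move: theta_labels theta_words => D R uD D3 cR single ef' /allP chk ox.
have [A2 A3] := attachments_large uD ef' conn3 cut3 ox D3.
have link : linkable R (attachments D f x).
  apply/allP => s sA; apply/allP => t tA.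
  have [->|st] //= := eqVneq s t; have [//|/= nst] := boolP (padj s t).
  have [y [p [_ _ _ _ /= [wR _ wA hs ht]]]] :=
    connecting_trace no_long uD ef' single cR ox sA tA st nst.
  apply/hasP; exists (firsts (trace D f (y :: p))) => //.
  by rewrite /starts_ends hs ht !eqxx /=; apply/allP => k /wA.
have attD : attachments D f x \in sublists D by apply: filter_sublists.
have := chk _ attD; rewrite link A2 /=.
move/implyP; apply; apply/implyP => /eqP/A3 nadj.
by apply/allP => i iA; apply/allP => j jA; apply: nadj.
Qed.

(** Different attachment sets belong to different components. Bridges join [e], an end of the common
    middle edge, to [s] and to [t]; the hole is closed through 3-2-6-5 or 7-0-4-5. *)
Lemma same_chord e s t m m' A A' x x' :
  (e, s, t, m, m', A, A') \in
    [:: (0, 3, 5, 1, 7, [:: 0; 1; 3; 4], [:: 0; 4; 5; 7]);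
        (2, 7, 5, 1, 3, [:: 1; 2; 6; 7], [:: 2; 3; 5; 6])] ->
  outside theta_labels f x -> outside theta_labels f x' ->
  attachments theta_labels f x = A -> attachments theta_labels f x' = A' ->
  False.
Proof.
set L := [:: _; _] => inL ox ox' xA xA'.
have chk : all (fun '(e, s, t, m, m', A, A') =>
    [&& forces_bridge theta_labels theta_words A e s m,
        forces_bridge theta_labels theta_words A' e t m',
        e \in theta_labels, e != m, e != m',
        A != A' &
        has (fun q => joins s t [:: e; m; m'] q && all (fun i => ~~ padj e i) q)
            (ipaths theta_labels padj 4)]) L by vm_compute.
have uD : uniq theta_labels by [].
move: theta_closed theta_single ef ox ox' xA xA' chk uD.
move: theta_labels theta_words L inL => D R L inL cR single ef' ox ox' xA xA'.
move=> /allP/(_ _ inL)/and5P[b b' eD em /and3P[em' AA' q4]] uD.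
apply: (@two_bridges D f x x' e s t m m') => //.
- by apply: contra AA' => /connect_attachments xx'; rewrite -xA -xA' xx'.
- by apply: attachments_bridge cR ox _; rewrite ?xA.
by apply/bridge_sym/(attachments_bridge _ _ _ cR ox'); rewrite ?xA'.
Qed.

Lemma theta_neighbor i : i \in [:: 1; 3; 5; 7] ->
  exists2 x, outside theta_labels f x & i \in attachments theta_labels f x.
Proof.
move=> i4.
have chk : all (fun i => [&& i \in theta_labels,
    has (fun j => (j != i) && ~~ padj i j) theta_labels &
    size [seq k <- theta_labels | padj i k] < 3]) [:: 1; 3; 5; 7] by vm_compute.
have /and3P[iD /hasP[j jD /andP[ji nij]] sz] := allP chk _ i4.
have [x ox xi] := outside_neighbor ef conn3 iD jD ji nij sz.
by exists x => //; apply/attachmentsP; split=> //; exists x.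
Qed.

Lemma theta_absurd : False.
Proof.
have nbr i : i \in [:: 1; 3; 5; 7] -> exists2 x, outside theta_labels f x &
    attachments theta_labels f x \in [seq A <- theta_attachments | i \in A].
  move=> /theta_neighbor[x ox xi]; exists x => //.
  by rewrite mem_filter xi theta_attachmentsE.
have chord0 x x' := @same_chord 0 3 5 1 7 [:: 0; 1; 3; 4] [:: 0; 4; 5; 7] x x' isT.
have chord2 x x' := @same_chord 2 7 5 1 3 [:: 1; 2; 6; 7] [:: 2; 3; 5; 6] x x' isT.
have [x1 o1 /=] := nbr 1 isT; have [x3 o3 /=] := nbr 3 isT.
have [x5 o5 /=] := nbr 5 isT; have [x7 o7 /=] := nbr 7 isT.
(* Each set contains two of 1, 3, 5, 7, and sets with different middle edges share one of these. One
   set per middle edge would thus cover only three labels, so two sets with the same middle edge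
   occur. *)
rewrite !inE => /orP[]/eqP A7 /orP[]/eqP A5 /orP[]/eqP A3 /orP[]/eqP A1;
  by [apply: chord0 A1 A5 | apply: chord0 A1 A7 | apply: chord0 A3 A5 |
      apply: chord0 A3 A7 | apply: chord2 A1 A5 | apply: chord2 A1 A3 |
      apply: chord2 A7 A5 | apply: chord2 A7 A3].
Qed.

End Theta.

End Main.

(** * Concrete models *)

Lemma inord_eq n i j : i <= n -> j <= n -> (inord i == inord j :> 'I_n.+1) = (i == j).
Proof. by move=> i_n j_n; rewrite -val_eqE /= !inordK. Qed.

(** A labelling that carries [padj] to disjointness. The default is also a pair of distinct numbers,
    so [kneser_set] has two elements for every [i]. *)
Definition kneser_pair (i : nat) : nat * nat :=
  nth (0, 1) [:: (0, 1); (2, 3); (0, 4); (1, 2); (3, 4); (0, 2); (1, 3); (2, 4);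
                 (1, 4); (0, 3)] i.

Definition kneser_set (i : nat) : {set 'I_5} :=
  [set inord (kneser_pair i).1; inord (kneser_pair i).2].

Lemma kneser_pairP i :
  [/\ (kneser_pair i).1 <= 4, (kneser_pair i).2 <= 4 &
      (kneser_pair i).1 != (kneser_pair i).2].
Proof. by do 10?[case: i => [|i] //]; rewrite /kneser_pair nth_default. Qed.

Lemma card_kneser_set i : #|kneser_set i| == 2.
Proof. by have [a b ab] := kneser_pairP i; rewrite cards2 inord_eq // ab. Qed.

Definition kneser_vertex (i : nat) : petersen :=
  exist (fun A : {set 'I_5} => #|A| == 2) (kneser_set i) (card_kneser_set i).

Lemma kneser_edge i j : i < 10 -> j < 10 ->
  edge (kneser_vertex i) (kneser_vertex j) = padj i j.
Proof.
move=> i10 j10; rewrite /= /petersen_edge /=.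
have [ia ib _] := kneser_pairP i; have [ja jb _] := kneser_pairP j.
rewrite disjoints_subset subUset !sub1set !inE !inord_eq //.
have : all (fun i => all (fun j =>
  (let: (a, b) := kneser_pair i in let: (c, d) := kneser_pair j in
   ~~ ((a == c) || (a == d)) && ~~ ((b == c) || (b == d))) == padj i j)
   (iota 0 10)) (iota 0 10) by vm_compute.
move=> /allP/(_ i); rewrite mem_iota => /(_ i10)/allP/(_ j).
rewrite mem_iota => /(_ j10)/eqP <-.
by case: (kneser_pair i) => a b; case: (kneser_pair j).
Qed.

(** Distinct labels have different neighbourhoods in [padj]. *)
Lemma kneser_inj : {in iota 0 10 &, injective kneser_vertex}.
Proof.
move=> i j iD jD ij; have : all (fun i => all (fun j => (i == j) ||
    has (fun k => padj i k != padj j k) (iota 0 10)) (iota 0 10)) (iota 0 10).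
  by vm_compute.
move=> /allP/(_ i iD)/allP/(_ j jD)/predU1P[//|/hasP[k]].
rewrite !mem_iota /= in iD jD * => kD.
by rewrite -!kneser_edge // ij eqxx.
Qed.

Lemma card_petersen : #|petersen| = 10.
Proof.
rewrite card_sig (@eq_card _ _ [set A : {set 'I_5} | #|A| == 2]).
  by rewrite card_draws card_ord.
by move=> A; rewrite !inE.
Qed.

Lemma embeds_petersen (G : sgraph) (f : nat -> G) :
  embeds (iota 0 10) padj f -> (forall x, ~ outside (iota 0 10) f x) ->
  isomorphic G petersen.
Proof.
move=> [fi fe] noout; set D := iota 0 10 in fi fe noout.
have fD x : x \in map f D by apply/negPn/negP/noout.
pose g x := index x (map f D).
have gD x : g x \in D.
  by rewrite mem_iota /= add0n -[10](size_map f D) index_mem.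
have fg x : f (g x) = x.
  have xlt : g x < 10 by have := gD x; rewrite mem_iota.
  have := nth_index x (fD x); rewrite (nth_map 0) ?size_iota // nth_iota //.
exists (fun x => kneser_vertex (g x)) => [|x y]; last first.
  rewrite kneser_edge -?fe ?fg //; have := gD x; have := gD y;
  by rewrite !mem_iota.
(* Injectivity suffices, as [f] already provides ten vertices of [G]. *)
apply: inj_card_bij.
  by move=> x y /(kneser_inj (gD x) (gD y)) xy; rewrite -(fg x) xy fg.
rewrite card_petersen; apply: (@leq_trans (size (map f D))); first by rewrite size_map.
rewrite -(card_uniqP _) ?max_card // map_inj_in_uniq ?iota_uniq //.
Qed.

Lemma theta_plus_padj (a b : 'I_8) : theta_plus_edge a b = padj a b.
Proof.
case: a => [] [|[|[|[|[|[|[|[|]]]]]]]] //= ?; case: b => [] [|[|[|[|[|[|[|[|]]]]]]]] //=.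
Qed.

Lemma has_theta_plus_embeds (G : sgraph) :
  has_induced G theta_plus -> exists f : nat -> G, embeds theta_labels padj f.
Proof.
case=> S [h [k hk kh] he]; exists (fun i => val (k (inord i : 'I_8))).
split=> i j; rewrite !mem_iota /= add0n => i8 j8.
  move/val_inj/(can_inj kh)/eqP; rewrite inord_eq //.
  by move/eqP.
rewrite -[LHS]/(edge (k (inord i) : induced S) (k (inord j))) -he !kh.
by rewrite [LHS]theta_plus_padj !inordK.
Qed.

Theorem theorem1p6 (G : sgraph)
    (G_conn : k_connected 3 G)
    (G_G2 : in_G2 G)
    (G_cut : forall S : {set G}, k_cutset 3 S -> stable S)
    (G_not_petersen : ~ isomorphic G petersen) :
  ~ has_induced G theta_plus.
Proof.
case/has_theta_plus_embeds=> f ef; have [g5 nolong] := G_G2.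
have short (c : seq G) : is_hole c -> odd (size c) -> size c < 7.
  by move=> hc oc; rewrite ltnNge; apply/negP => c7; apply: nolong; exists c.
(* A copy of the Petersen graph would be all of [G], against [G_not_petersen]. *)
apply: (theta_absurd G_conn g5 short G_cut _ ef) => h eh.
apply: G_not_petersen; apply: (embeds_petersen eh) => x.
exact: (petersen_spanning G_conn g5 short G_cut eh).
Qed.
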